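(* Let $N\ge k+1\ge 1$ be integers, $\varepsilon>0$, and let $b=\frac{2\binom{N}{k+1}}{\varepsilon}$. Suppose that for every $\mathcal{A}'\subseteq\mathcal{A}$ with $|\mathcal{A}'|=k+1$, each data holder shares $\tilde{\mathbf{c}}_{\mathcal{A}'}=\mathbf{c}_{\mathcal{A}'}+\boldsymbol{\eta}$, where $\mathbf{c}_{\mathcal{A}'}$ is the joint frequency distribution of the attributes in $\mathcal{A}'$ in the holder's own dataset, viewed as a vector of dimension $d=|d_{\mathcal{A}'}|$, and $\boldsymbol{\eta}=[\eta_1\ \dots\ \eta_d]^T$ is a random vector of i.i.d. $\mathrm{Laplace}(0,b)$ entries. Then the algorithm ''Sharing the Noisy Sufficient Statistics'' preserves $\varepsilon$-differential privacy for any dataset $D_j$, $j\in\{1,\dots,M\}$.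
   Context: Data: $\mathcal{A}=\{X_1,\dots,X_N\}$ is a set of $N$ attributes, each with a finite domain. There are $M$ data holders; holder $j$ has a dataset $D_j$, a finite collection of records $\mathbf{x}=(x_1,\dots,x_N)$ with $x_i\in\mathrm{domain}(X_i)$. For $\mathcal{A}'\subseteq\mathcal{A}$, $d_{\mathcal{A}'}$ is the Cartesian product of the domains of the attributes in $\mathcal{A}'$ with a fixed ordering of its elements, $d_{\mathcal{A}'}[i]$ is its $i$-th element, and for a dataset $D$ the joint frequency distribution is $\mathbf{c}_{\mathcal{A}'}=[c_1\ \dots\ c_d]^T$ with $c_i$ the number of records $\mathbf{x}\in D$ whose restriction to $\mathcal{A}'$ equals $d_{\mathcal{A}'}[i]$. $\mathrm{Laplace}(\mu,b)$ has density $\frac{1}{2b}e^{-|x-\mu|/b}$. Fresh independent noise is used for each holder and each $\mathcal{A}'$. Algorithm ''Sharing the Noisy Sufficient Statistics'': an untrusted analyst retrieves from every holder $j$ the noisy vector $\tilde{\mathbf{c}}^{(j)}_{\mathcal{A}'}$ for every $\mathcal{A}'\subseteq\mathcal{A}$ with $|\mathcal{A}'|=k+1$ (this is its only interaction with the data), and forms $\tilde{\mathbf{p}}_{\mathcal{A}'}=\frac1n\sum_j\tilde{\mathbf{c}}^{(j)}_{\mathcal{A}'}$, where $n$ is the total number of records. It then starts with an arbitrary attribute, placed in a set $V$ with an empty parent set, and repeats $N-1$ times: among all pairs $(X,\mathbf{Pa}(X))$ with $X\in\mathcal{A}\setminus V$, $\mathbf{Pa}(X)\subseteq V$, $|\mathbf{Pa}(X)|\le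 k$, it selects the one with the highest mutual information computed from (marginals of) the vectors $\tilde{\mathbf{p}}_{\mathcal{A}'}$, adds the pair to the structure $\mathcal{G}$ and $X$ to $V$. It outputs $\mathcal{G}$. Differential privacy (bounded version): two datasets are adjacent if one is obtained from the other by changing the value of a single record (so they have the same size). A randomized algorithm $\mathbf{Alg}$ is $\varepsilon$-differentially private if for all sets $O$ of outputs and all adjacent $D,D'$, $\mathbb{P}[\mathbf{Alg}(D)\in O]\le e^{\varepsilon}\,\mathbb{P}[\mathbf{Alg}(D')\in O]$. ''For any dataset $D_j$'' means that this holds with $D_j$ as the input that is changed to an adjacent dataset, the datasets of the other holders being fixed; everything the analyst sees or outputs is regarded as output. *)

(* Defs.v *)
From HB Require Import structures.
From mathcomp Require Import all_boot all_order all_algebra.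
From mathcomp Require Import all_classical all_reals all_analysis.
From mathcomp Require Import measurable_realfun.

Set Implicit Arguments.
Unset Strict Implicit.
Unset Printing Implicit Defensive.

Import Order.TTheory GRing.Theory Num.Theory.
Import numFieldNormedType.Exports.
Local Open Scope classical_set_scope.
Local Open Scope ring_scope.

Definition laplace_pdf (R : realType) (mu b x : R) : R :=
  (2 * b)^-1 * expR (- (`|x - mu| / b)).

Definition is_laplace d (T : measurableType d) (R : realType)
    (P : probability T R) (mu b : R) (X : {RV P >-> R}) : Prop :=
  forall B : set R, measurable B ->
    distribution P X B = (\int[lebesgue_measure]_(x in B) (laplace_pdf mu b x)%:E)%E.

Definition mutually_independent d (T : measurableType d) (R : realType)
    (P : probability T R) (I : finType) (X : I -> {RV P >-> R}) : Prop :=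
  forall (J : {set I}) (B : I -> set R), (forall i, measurable (B i)) ->
    P (\bigcap_(i in [set` J]) (X i @^-1` B i)) =
    (\prod_(i in J) P (X i @^-1` B i))%E.

Definition differentially_private d (Omega : measurableType d) (R : realType)
    (P : probability Omega R) (input : Type) d' (T : measurableType d')
    (adj : input -> input -> Prop) (eps : R)
    (alg : input -> {RV P >-> T}) : Prop :=
  forall D D' : input, adj D D' -> forall O : set T, measurable O ->
    (distribution P (alg D) O <= (expR eps)%:E * distribution P (alg D') O)%E.

Section data.
Variables (N : nat) (dom : 'I_N -> finType).

Definition record : Type := {dffun forall i : 'I_N, dom i}.

Definition dataset : Type := seq record.

(* Datasets are unordered: the changed record may sit at any position. *)
Definition adjacent_datasets (D D' : dataset) : Prop :=
  exists (s : dataset) (x x' : record),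
    perm_eq D (x :: s) /\ perm_eq D' (x' :: s).

(* The product of the domains of the attributes in A; its fixed ordering is
   the enumeration [enum_val : 'I_#|cell A| -> cell A]. *)
Definition cell (A : {set 'I_N}) : finType :=
  {dffun forall i : {i : 'I_N | i \in A}, dom (val i)}.

Definition restrict_to (A : {set 'I_N}) (x : record) : cell A :=
  [ffun i : {i : 'I_N | i \in A} => x (val i)].

(* z and y take the same values on the common attributes of A and B; when B is
   a subset of A this says that y is the restriction of z to B. *)
Definition agree (A B : {set 'I_N}) (z : cell A) (y : cell B) : bool :=
  [forall a : {i : 'I_N | i \in A}, [forall b : {i : 'I_N | i \in B},
    (val a == val b) ==> (Tagged dom (z a) == Tagged dom (y b))]].

Variable R : realType.

Definition freq (D : dataset) (A : {set 'I_N}) : 'cV[R]_#|cell A| :=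
  \col_i (count (fun x => restrict_to A x == enum_val i) D)%:R.

(* Mutual information of attribute X and the attribute set Pa, for a vector p
   indexed by the cells of A, where X |: Pa is a subset of A.  Noisy vectors
   may have entries or marginals that are not positive; the library
   conventions [ln x = 0] for [x <= 0] and [0^-1 = 0] then apply. *)
Definition mutual_info (A : {set 'I_N}) (p : 'cV[R]_#|cell A|)
    (X : 'I_N) (Pa : {set 'I_N}) : R :=
  let pr (e : pred (cell A)) := \sum_(z | e z) p (enum_rank z) 0 in
  \sum_(x : cell [set X]%SET) \sum_(u : cell Pa)
    let pxu := pr (fun z => agree z x && agree z u) in
    pxu * ln (pxu / (pr (fun z => agree z x) * pr (fun z => agree z u))).

End data.

Definition ksubset (N k : nat) : finType :=
  {A : {set 'I_N} | #|A| == k.+1}.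

Definition network (N : nat) : Type := {set 'I_N * {set 'I_N}}.

HB.instance Definition _ N := Finite.on (network N).
HB.instance Definition _ N := isPointed.Build (network N) finset.set0.
HB.instance Definition _ N := @isMeasurable.Build default_measure_display
  (network N) discrete_measurable discrete_measurable0
  discrete_measurableC discrete_measurableU.

Section learning.
Variables (R : realType) (N k : nat).
Local Notation attr := 'I_N.
Local Notation candidate := (attr * {set attr})%type.

Definition candidates (V : {set attr}) : {set candidate} :=
  [set c : candidate | [&& c.1 \notin V, c.2 \subset V & #|c.2| <= k]%N]%SET.

Definition maximizers (score : candidate -> R) (S : {set candidate}) :
    {set candidate} :=
  [set c in S | [forall c' in S, score c' <= score c]]%SET.

(* [tie G S] selects one pair from the set S of those of highest score, given
   the structure G built so far. *)
Variable tie : network N -> {set candidate} -> candidate.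

Definition learn_step (score : candidate -> R) (s : {set attr} * network N) :
    {set attr} * network N :=
  let c := tie s.2 (maximizers score (candidates s.1)) in
  (c.1 |: s.1, c |: s.2)%SET.

Definition learn (x0 : attr) (score : candidate -> R) : network N :=
  (iter N.-1 (learn_step score)
     ([set x0]%SET, [set (x0, finset.set0)]%SET)).2.

Let le_rel := {ffun candidate * candidate -> bool}.

Let step_rel (r : le_rel) (s : {set attr} * network N) :
    {set attr} * network N :=
  let S := candidates s.1 in
  let c := tie s.2 [set c in S | [forall c' in S, r (c', c)]]%SET in
  (c.1 |: s.1, c |: s.2)%SET.

Let learn_rel x0 (r : le_rel) : network N :=
  (iter N.-1 (step_rel r) ([set x0]%SET, [set (x0, finset.set0)]%SET)).2.

Let learn_relE x0 score :
  learn x0 score = learn_rel x0 [ffun p => score p.1 <= score p.2].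
Proof.
rewrite /learn /learn_rel; congr (_.2); apply: eq_iter => s.
rewrite /learn_step /step_rel.
suff -> : maximizers score (candidates s.1) =
  [set c in candidates s.1 | [forall c' in candidates s.1,
     [ffun p : candidate * candidate => score p.1 <= score p.2] (c', c)]]%SET
  by [].
apply/setP => c; rewrite !inE; congr (_ && _).
by apply: eq_forallb => c'; rewrite ffunE.
Qed.

Lemma measurable_learn d (Omega : measurableType d) x0
    (score : Omega -> candidate -> R) :
  (forall c, measurable_fun setT (score ^~ c)) ->
  measurable_fun setT (fun w => learn x0 (score w)).
Proof.
move=> mscore _ B _; rewrite setTI.
pose r w : le_rel := [ffun p => score w p.1 <= score w p.2].
have -> : (fun w => learn x0 (score w)) @^-1` B =
    \bigcup_(f in [set f | B (learn_rel x0 f)]) (r @^-1` [set f]).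
  apply/seteqP; split=> [w /= Bw|w [f /= Bf rf]].
    by exists (r w) => //=; rewrite -learn_relE.
  by rewrite /= learn_relE -/(r w) rf.
apply: fin_bigcup_measurable => [|f _]; first exact: finite_finset.
have -> : r @^-1` [set f] =
    \bigcap_(p in [set: candidate * candidate])
      ((fun w => score w p.1 <= score w p.2) @^-1` [set f p]).
  apply/seteqP; split=> [w /= <- p _ /=|w /= rw]; first by rewrite ffunE.
  by apply/ffunP => p; rewrite ffunE; exact: rw.
apply: fin_bigcap_measurable => [|p _]; first exact: finite_finset.
rewrite -[X in measurable X]setTI.
by apply: (measurable_fun_ler (mscore p.1) (mscore p.2)).
Qed.

End learning.

Definition noisy_stats (R : realType) (M N k : nat) (dom : 'I_N -> finType) :=
  forall (j : 'I_M) (A : ksubset N k), 'cV[R]_#|cell dom (val A)|.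

HB.instance Definition _ R M N k dom := gen_eqMixin (@noisy_stats R M N k dom).
HB.instance Definition _ R M N k dom :=
  gen_choiceMixin (@noisy_stats R M N k dom).
HB.instance Definition _ R M N k dom :=
  isPointed.Build (@noisy_stats R M N k dom) (fun _ _ => 0).

(* [noisy_stats] with the product sigma-algebra *)
Definition transcript (R : realType) (M N k : nat) (dom : 'I_N -> finType) :=
  g_sigma_algebraType [set B : set (@noisy_stats R M N k dom) |
    exists (j : 'I_M) (A : ksubset N k) (i : 'I_#|cell dom (val A)|)
           (C : set R),
      measurable C /\ B = [set v | C (v j A i 0)]].

HB.instance Definition _ R M N k dom :=
  Measurable.on (@transcript R M N k dom).

Section sharing.
Variables (R : realType) (N k M : nat) (dom : 'I_N -> finType).
Variables (d : measure_display) (Omega : measurableType d).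
Variable P : probability Omega R.
Variable eta : forall (j : 'I_M) (A : ksubset N k),
  'I_#|cell dom (val A)| -> {RV P >-> R}.
Variable x0 : 'I_N.
(* [cover X Pa] is the set A' whose vector is marginalized to compute the
   mutual information of X and Pa. *)
Variable cover : 'I_N -> {set 'I_N} -> ksubset N k.
Variable tie :
  network N -> {set 'I_N * {set 'I_N}} -> 'I_N * {set 'I_N}.

Definition share (D : 'I_M -> dataset dom) (w : Omega) :
    transcript R M k dom :=
  fun j A => freq R (D j) (val A) + \col_i eta j i w.

Definition aggregate (n : nat) (c : transcript R M k dom) (A : ksubset N k) :
    'cV[R]_#|cell dom (val A)| :=
  n%:R^-1 *: \sum_j c j A.

Definition score (n : nat) (c : transcript R M k dom)
    (q : 'I_N * {set 'I_N}) : R :=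
  mutual_info (aggregate n c (cover q.1 q.2)) q.1 q.2.

(* The noisy vectors are all that the analyst sees of the data, so they are
   part of the output. *)
Definition share_and_learn (D : 'I_M -> dataset dom) (w : Omega) :
    transcript R M k dom * network N :=
  let c := share D w in
  (c, learn k tie x0 (score (\sum_j size (D j))%N c)).

Lemma measurable_share D : measurable_fun setT (share D).
Proof.
apply: measurability => //.
move=> _ [_ [j [A [i [C [mC ->]]]]] <-].
rewrite [X in measurable X](_ : _ = setT `&`
    (fun w => freq R (D j) (val A) i 0 + eta j i w) @^-1` C).
  by apply: measurable_funD => //; exact: measurable_funPT.
by apply/seteqP; split=> w /=; rewrite !mxE.
Qed.

Lemma measurable_share_and_learn D : measurable_fun setT (share_and_learn D).
Proof.
have minv : measurable_fun [set: R] (@GRing.inv R).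
  rewrite (_ : GRing.inv = fun x : R => x * (x ^+ 2) `^ (-1)).
    apply: measurable_funM => //.
    by apply: (measurableT_comp (measurable_powR _)); exact: measurable_funX.
  apply/funext => x; have [->|x0'] := eqVneq x 0; first by rewrite invr0 mul0r.
  by rewrite powR_inv1 ?sqr_ge0// expr2 invfM mulrA divff ?mul1r.
apply: measurable_fun_pair; first exact: measurable_share.
apply: measurable_learn => -[X Pa]; rewrite /score /mutual_info /=.
have mpr (e : pred (cell dom (val (cover X Pa)))) : measurable_fun setT (fun w =>
    \sum_(z | e z) aggregate (\sum_j size (D j))%N (share D w) (cover X Pa)
      (enum_rank z) 0).
  under eq_fun do rewrite big_mkcond /=.
  apply: measurable_sum => z; case: (e z) => //.
  under eq_fun do rewrite mxE summxE.
  apply: measurable_funM => //; apply: measurable_sum => j.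
  under eq_fun do rewrite !mxE.
  by apply: measurable_funD => //; exact: measurable_funPT.
apply: measurable_sum => x; apply: measurable_sum => u.
apply: measurable_funM => //; apply: (measurableT_comp (@measurable_ln R)).
apply: measurable_funM => //; apply: (measurableT_comp minv).
exact: measurable_funM.
Qed.

HB.instance Definition _ D := isMeasurableFun.Build _ _ _ _
  (share_and_learn D) (measurable_share_and_learn D).

Definition sharing_noisy_stats (D : 'I_M -> dataset dom) :
    {RV P >-> (transcript R M k dom * network N)%type} := share_and_learn D.

End sharing.

(* Main.v *)
Require Import Defs.
From HB Require Import structures.
From mathcomp Require Import all_boot all_order all_algebra.
From mathcomp Require Import all_classical all_reals all_analysis.
From mathcomp Require Import measurable_realfun lra.

(* Changing one record of D_j moves each of the C(N, k+1) frequency vectors of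
   holder j by at most 2 in L1 norm, and moves no other one.  The shared vectors
   are independent Laplace noises translated by the frequencies, and translating
   a single Laplace(0, b) noise by r changes its law by a factor at most
   e^(|r|/b).  Moving the coordinates one at a time, each step being an
   inequality between integrals of sections because the moved coordinate is
   independent of the others, the factors multiply up to
   e^(2 C(N, k+1) / b) = e^eps.  The learnt structure is a measurable function
   of the shared vectors which depends on the data only through the total
   number of records, unchanged between adjacent datasets. *)

Set Implicit Arguments.
Unset Strict Implicit.
Unset Printing Implicit Defensive.

Import Order.TTheory GRing.Theory Num.Theory.
Local Open Scope classical_set_scope.
Local Open Scope ring_scope.

(** * Translated Laplace laws *)

Definition translation (R : realType) (s x : measurableTypeR R) :
  measurableTypeR R := x + s.

Lemma measurable_translation (R : realType) (s : R) :
  measurable_fun setT (translation s).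
Proof. exact: measurable_funD. Qed.

HB.instance Definition _ (R : realType) (s : R) := isMeasurableFun.Build _ _ _ _
  (translation s) (measurable_translation s).

(** The Lebesgue measure is determined by its values on the intervals []a, b]], and a translation
    pulls these back to intervals of the same length. *)
Lemma lebesgue_measure_translation (R : realType) (s : R) (A : set R) :
  measurable A ->
  pushforward lebesgue_measure (translation s) A = lebesgue_measure A.
Proof.
move=> mA; apply/esym/lebesgue_measure_unique => //= _ [[a b]] _ <-.
rewrite /pushforward.
have -> : translation s @^-1` [set` `]a, b]] = [set` `]a - s, b - s]].
  by apply/seteqP; split=> x /=; rewrite !in_itv/= /translation ltrBlDr lerBrDr.
by rewrite !lebesgue_measure_itv/= !lte_fin ltrD2r -!EFinB opprB subrKA.
Qed.

Lemma laplace_pdf_ge0 (R : realType) (mu b x : R) :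
  0 <= b -> 0 <= laplace_pdf mu b x.
Proof. by move=> b0; rewrite mulr_ge0 ?expR_ge0// invr_ge0 mulr_ge0. Qed.

Lemma measurable_laplace_pdf (R : realType) (mu b : R) :
  measurable_fun setT (laplace_pdf mu b).
Proof.
apply: measurable_funM => //; apply: (measurableT_comp (@measurable_expR R)).
apply: measurableT_comp => //; apply: measurable_funM => //.
apply: (measurableT_comp (@normr_measurable R setT)) => //.
exact: measurable_funB.
Qed.

(** The triangle inequality in the exponent, applied to [x - t = (x - s) + (s - t)]. *)
Lemma laplace_pdf_shift (R : realType) (b s t x : R) : 0 < b ->
  laplace_pdf 0 b (x - s) <= expR (`|s - t| / b) * laplace_pdf 0 b (x - t).
Proof.
move=> b0; rewrite /laplace_pdf !subr0 mulrCA ler_pM2l ?invr_gt0 ?mulr_gt0//.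
rewrite -expRD ler_expR -!mulNr -mulrDl ler_pM2r ?invr_gt0//.
have : `|x - t| <= `|x - s| + `|s - t| by rewrite -(subrKA s) ler_normD.
by lra.
Qed.

Section laplace_law.
Context (R : realType) d (Omega : measurableType d) (P : probability Omega R).
Variables (b : R) (Z : {RV P >-> R}).
Hypotheses (b0 : 0 < b) (ZL : is_laplace 0 b Z).

Lemma laplace_shift_law (s : R) (A : set R) : measurable A ->
  P ((fun w => Z w + s)%R @^-1` A) =
  (\int[lebesgue_measure]_(x in A) (laplace_pdf 0 b (x - s))%:E)%E.
Proof.
move=> mA.
have mAs : measurable (translation s @^-1` A).
  by rewrite -[X in measurable X]setTI; exact: measurable_translation.
rewrite (_ : P _ = distribution P Z (translation s @^-1` A))// ZL//.
transitivity (\int[pushforward lebesgue_measure (translation s)]_(x in A)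
    (laplace_pdf 0 b (x - s))%:E)%E.
  rewrite ge0_integral_pushforward//=.
  - by apply: eq_integral => x _; rewrite /= /translation addrK.
  - apply/measurable_EFinP; apply: measurable_funTS.
    apply: (measurableT_comp (measurable_laplace_pdf 0 b)).
    exact: measurable_funB.
  - by move=> x _; rewrite lee_fin laplace_pdf_ge0// ltW.
by apply: eq_measure_integral => // B mB _; exact: lebesgue_measure_translation.
Qed.

Lemma laplace_shift_le (s t : R) (A : set R) : measurable A ->
  (P ((fun w => Z w + s)%R @^-1` A) <=
   (expR (`|s - t| / b))%:E * P ((fun w => Z w + t)%R @^-1` A))%E.
Proof.
move=> mA; rewrite !laplace_shift_law//.
have mpdf u : measurable_fun A (fun x => laplace_pdf 0 b (x - u)).
  apply: measurable_funTS.
  apply: (measurableT_comp (measurable_laplace_pdf 0 b)).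
  exact: measurable_funB.
have pdf0 u (x : R) : A x -> (0 <= (laplace_pdf 0 b (x - u))%:E)%E.
  by move=> _; rewrite lee_fin laplace_pdf_ge0// ltW.
have mEpdf u : measurable_fun A (fun x => (laplace_pdf 0 b (x - u))%:E).
  exact/measurable_EFinP.
rewrite -ge0_integralZl//; last 2 first.
- exact: mEpdf.
- exact: pdf0.
apply: ge0_le_integral => //.
- exact: pdf0.
- exact: mEpdf.
- by apply: emeasurable_funM; [exact: measurable_cst|exact: mEpdf].
- by move=> x _; rewrite -EFinM lee_fin laplace_pdf_shift.
Qed.

End laplace_law.

(** * Measurability in finite families of reals *)

Definition coord_fun (I : Type) (R : realType) := I -> R.

HB.instance Definition _ I R := gen_eqMixin (@coord_fun I R).
HB.instance Definition _ I R := gen_choiceMixin (@coord_fun I R).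
HB.instance Definition _ I R := isPointed.Build (@coord_fun I R) (fun=> 0).

Definition box (I : Type) (R : realType) (C : I -> set R) :
  set (coord_fun I R) := [set v | forall i, C i (v i)].

Definition boxes (I : Type) (R : realType) : set (set (coord_fun I R)) :=
  [set B | exists2 C : I -> set R, (forall i, measurable (C i)) & B = box C].

(* The boxes form a pi-system, which the cylinders generating a product
   sigma-algebra do not. *)
Definition coord_space (I : Type) (R : realType) :=
  g_sigma_algebraType (@boxes I R).

HB.instance Definition _ I R := Measurable.on (@coord_space I R).

Section coord_space.
Context (I : finType) (R : realType).

Lemma boxesT : @boxes I R setT.
Proof. by exists (fun=> setT) => //; apply/seteqP; split. Qed.

Lemma boxesI : setI_closed (@boxes I R).
Proof.
move=> _ _ [A mA ->] [B mB ->]; exists (fun i => A i `&` B i).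
  by move=> i; exact: measurableI.
apply/seteqP; split=> v /= => [[vA vB] i|vAB].
  by split; [exact: vA|exact: vB].
by split=> i; have [] := vAB i.
Qed.

Lemma measurable_coord (i : I) :
  measurable_fun setT (fun v : coord_space I R => v i).
Proof.
move=> _ C mC; apply: sub_sigma_algebra; rewrite setTI.
exists (fun j => if j == i then C else setT) => [j|]; first by case: ifP.
apply/seteqP; split=> v /= => [vC j|/(_ i)]; last by rewrite eqxx.
by case: eqP => [->|].
Qed.

(** The preimage of a box is the intersection, over the finite type [I], of preimages of measurable
    sets under the coordinates of [f]. *)
Lemma measurable_fun_coord d (T : measurableType d) (f : T -> coord_space I R) :
  (forall i, measurable_fun setT (fun x => f x i)) -> measurable_fun setT f.
Proof.
move=> mf; apply: measurability => // _ [_ [C mC ->] <-].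
rewrite (_ : _ `&` _ =
    \bigcap_(i in [set: I]) (setT `&` (fun x => f x i) @^-1` C i)).
  by apply: fin_bigcap_measurable => // i _; exact: mf.
apply/seteqP; split=> x /= => [[_ fC] i _|fC]; split=> // i.
by have [] := fC i Logic.I.
Qed.

(** Rectangles whose second side is a box form a pi-system, so finite measures on the product can be
    compared on them alone. *)
Lemma measurable_prod_boxes d (T : measurableType d) :
  @measurable _ (T * coord_space I R)%type =
  <<s [set A `*` B | A in measurable & B in @boxes I R] >>.
Proof.
set G := (X in <<s X >>); rewrite measurable_prod_measurableType.
apply/seteqP; split; apply: smallest_sub; try exact: smallest_sigma_algebra.
  move=> _ [A mA [B mB <-]].
  (* Both projections are measurable for the sigma-algebra generated by [G], and a rectangle is an
     intersection of their preimages. *)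
  have mfst : measurable_fun setT (fst : g_sigma_algebraType G -> T).
    move=> _ C mC; rewrite setTI; apply: sub_sigma_algebra.
    exists C => //; exists setT; first exact: boxesT.
    by rewrite setXT.
  have msnd :
      measurable_fun setT (snd : g_sigma_algebraType G -> coord_space I R).
    apply: measurability => // _ [C boxC <-]; apply: sub_sigma_algebra.
    by exists setT => //; exists C => //; rewrite setTX setTI.
  have -> : A `*` B = (setT `&` fst @^-1` A) `&` (setT `&` snd @^-1` B).
    by rewrite !setTI.
  by apply: (@measurableI _ (g_sigma_algebraType G)); [exact: mfst|exact: msnd].
move=> _ [A mA [B boxB <-]]; apply: sub_sigma_algebra.
exists A => //; exists B => //; exact: sub_sigma_algebra.
Qed.

End coord_space.

(** * Independence and product measures *)

Section joint_law.
Context (I : finType) (R : realType) d (Omega : measurableType d)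
  (P : probability Omega R).

(** Two finite measures that agree on a generating pi-system are equal; the assumed factorization is
    agreement on rectangles whose second side is a box. *)
Lemma joint_distribution (X : {RV P >-> R}) (Y : {RV P >-> coord_space I R}) :
  (forall (A : set R) (C : I -> set R),
     measurable A -> (forall i, measurable (C i)) ->
     P (X @^-1` A `&` Y @^-1` box C) = (P (X @^-1` A) * P (Y @^-1` box C))%E) ->
  forall S : set (R * coord_space I R), measurable S ->
    P ((fun w => (X w, Y w)) @^-1` S) =
    (distribution P X \x^ distribution P Y)%E S.
Proof.
move=> XY S mS.
have mXY : measurable_fun setT (fun w => (X w, Y w)).
  by apply: measurable_fun_pair; exact: measurable_funPT.
pose XYf : {mfun Omega >-> _} :=
  HB.pack (fun w => (X w, Y w)) (isMeasurableFun.Build _ _ _ _ _ mXY).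
pose prodXY : {measure set _ -> \bar R} :=
  (distribution P X \x^ distribution P Y)%E.
apply: (@measure_unique _ R _ _ (fun=> setT) (@measurable_prod_boxes I R _ R)
  _ _ _ (distribution P XYf) prodXY) => //.
- move=> _ _ [A mA [B bB <-]] [A' mA' [B' bB' <-]]; rewrite -setXI.
  exists (A `&` A'); first exact: measurableI.
  by exists (B `&` B') => //; exact: boxesI.
- by move=> _; exists setT => //; exists setT; [exact: boxesT|rewrite setXTT].
- by apply/seteqP; split=> // x _; exists 0%N.
- move=> _ [A mA [_ [C mC ->] <-]].
  rewrite [RHS]product_measure2E//; last by apply: sub_sigma_algebra; exists C.
  by rewrite -[RHS]XY//.
- by move=> _; rewrite -ge0_fin_numE// fin_num_measure.
Qed.

End joint_law.

(** [\x^] integrates over the second factor the first measure of the sections of [S], so the bound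
    applies under the integral sign. *)
Lemma product_measure2_le d1 d2
    (T1 : measurableType d1) (T2 : measurableType d2) (R : realType)
    (m m' : {sigma_finite_measure set T1 -> \bar R})
    (n : {measure set T2 -> \bar R}) (c : R) (S : set (T1 * T2)) :
  0 <= c -> (forall A, measurable A -> (m A <= c%:E * m' A)%E) ->
  measurable S ->
  ((m \x^ n) S <= c%:E * (m' \x^ n) S)%E.
Proof.
move=> c0 mm' mS; rewrite /product_measure2.
have mys (k : {sigma_finite_measure set T1 -> \bar R}) :=
  measurable_fun_ysection k mS.
rewrite -ge0_integralZl//.
apply: ge0_le_integral => //.
  by apply: emeasurable_funM; [exact: measurable_cst|exact: mys].
by move=> y _; apply: mm'; exact: measurable_ysection.
Qed.

(** * Translating independent Laplace noises *)

Section laplace_mechanism.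
Context (I : finType) (R : realType) d (Omega : measurableType d)
  (P : probability Omega R) (b : R) (Z : I -> {RV P >-> R}).
Hypotheses (b0 : 0 < b) (Zlaplace : forall i, is_laplace 0 b (Z i))
  (Zindep : mutually_independent Z).

Definition shifted (s : I -> R) (w : Omega) : coord_space I R :=
  fun i => Z i w + s i.

(** Turns an event on families into an event on pairs whose first component is coordinate [u]; the
    entry [xv.2 u] is overwritten. *)
Definition update (u : I) (xv : R * coord_space I R) : coord_space I R :=
  fun i => if i == u then xv.1 else xv.2 i.

Lemma measurable_update (u : I) : measurable_fun setT (update u).
Proof.
apply: measurable_fun_coord => i; rewrite /update; case: eqP => _.
  exact: measurable_fst.
exact: (measurableT_comp (measurable_coord i) measurable_snd).
Qed.

(** The shifted noise at [u] and the family of the others have a product law; between [s] and [t]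
    only its first factor differs, and [laplace_shift_le] compares the two. *)
Lemma shifted_update_le (u : I) (s t : I -> R) (B : set (coord_space I R)) :
  (forall i, i != u -> s i = t i) -> measurable B ->
  (P (shifted s @^-1` B) <=
   (expR (`|s u - t u| / b))%:E * P (shifted t @^-1` B))%E.
Proof.
move=> st mB.
(* Entry [u] is frozen at 0, so that [Y] depends only on the noises other than [Z u]. *)
pose Y w : coord_space I R := fun i => if i == u then 0 else Z i w + s i.
have mY : measurable_fun setT Y.
  apply: measurable_fun_coord => i; rewrite /Y; case: eqP => // _.
  by apply: measurable_funD => //; exact: measurable_funPT.
pose Yf : {RV P >-> coord_space I R} :=
  HB.pack Y (isMeasurableFun.Build _ _ _ _ _ mY).
have mX r : measurable_fun setT (fun w => Z u w + r).
  by apply: measurable_funD => //; exact: measurable_funPT.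
pose X r : {RV P >-> R} :=
  HB.pack (fun w => Z u w + r) (isMeasurableFun.Build _ _ _ _ _ (mX r)).
pose S := update u @^-1` B.
have mS : measurable S by rewrite -[S]setTI; exact: measurable_update.
have joint r : P ((fun w => (X r w, Yf w)) @^-1` S) =
    (distribution P (X r) \x^ distribution P Yf)%E S.
  apply: joint_distribution => // A C mA mC.
  (* Entry [u] of [Yf] is constantly 0: if [C u] misses 0, both sides vanish; otherwise [C u]
     imposes nothing. *)
  have [C0|C0] := pselect (C u 0); last first.
    have -> : Yf @^-1` box C = set0.
      by apply/seteqP; split=> w //= /(_ u); rewrite /Y eqxx.
    by rewrite setI0 measure0 mule0.
  (* The conditions are pulled back to the unshifted noises, slot [u] holding the one on [X r].
     Independence over all of [I] and over [[set~ u]] then gives the factorization. *)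
  pose shiftC i := if i == u then translation r @^-1` A
                   else translation (s i) @^-1` C i.
  have mshiftC i : measurable (shiftC i).
    by rewrite /shiftC; case: ifP => _; rewrite -[X in measurable X]setTI;
      apply: measurable_translation => //; exact: mC.
  have YC : Yf @^-1` box C =
      \bigcap_(i in [set` [set~ u]%SET]) (Z i @^-1` shiftC i).
    apply/seteqP; split=> [w /= YwC i|w /= ZwC i].
      rewrite /= !inE => /negbTE iu; have := YwC i; rewrite /Y/= iu.
      by rewrite /shiftC iu.
    rewrite /= /Y; have [->|iu] := eqVneq i u; first by [].
    have := ZwC i; rewrite /= !inE => /(_ iu).
    by rewrite /shiftC (negbTE iu).
  have XA : X r @^-1` A = Z u @^-1` shiftC u by rewrite /shiftC eqxx.
  have XYC : X r @^-1` A `&` Yf @^-1` box C =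
      \bigcap_(i in [set` [set: I]%SET]) (Z i @^-1` shiftC i).
    rewrite YC XA; apply/seteqP; split=> [w /= [Zu ZwC] i _|w /= ZwC].
      have [->//|iu] := eqVneq i u; apply: ZwC => /=; by rewrite !inE.
    by split=> [|i _]; apply: ZwC; rewrite /= inE.
  rewrite XYC Zindep// YC Zindep// XA (bigD1 u) ?inE//=; congr (_ * _)%E.
  by apply: eq_bigl => i; rewrite !inE.
(* The families shifted by [s] and by [t] are updates of the same [Y], with [r] equal to [s u] and
   [t u] respectively. *)
have shiftedE r (t' : I -> R) : (forall i, i != u -> t' i = s i) -> t' u = r ->
    shifted t' @^-1` B = (fun w => (X r w, Yf w)) @^-1` S.
  move=> t's t'u; rewrite /S -comp_preimage; congr (_ @^-1` B).
  apply/funext => w; apply/funext => i; rewrite /shifted /update /=.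
  by rewrite /Y /translation; have [->|/t's ->//] := eqVneq i u; rewrite t'u.
rewrite (shiftedE (s u))// (shiftedE (t u))//; last by move=> i /st.
rewrite !joint; apply: product_measure2_le => //.
by move=> A mA; exact: (laplace_shift_le b0 (Zlaplace u)).
Qed.

(** Induction on [l] with [s] generalized: the entries listed in [l] are moved in turn from [s] to
    [t], and the exponential factors multiply. *)
Lemma shifted_le_seq (l : seq I) (s t : I -> R) (B : set (coord_space I R)) :
  (forall i, i \notin l -> s i = t i) -> measurable B ->
  (P (shifted s @^-1` B) <=
   (expR ((\sum_(i <- l) `|s i - t i|) / b))%:E * P (shifted t @^-1` B))%E.
Proof.
move=> + mB; elim: l s => [|u l IH] s st.
  rewrite big_nil mul0r expR0 mul1e (_ : s = t)//.
  by apply/funext => i; exact: st.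
pose m i := if i == u then t u else s i.
have /le_trans -> // : (P (shifted s @^-1` B) <=
    (expR (`|s u - t u| / b))%:E * P (shifted m @^-1` B))%E.
  rewrite (_ : t u = m u); last by rewrite /m eqxx.
  by apply: shifted_update_le => // i iu; rewrite /m (negbTE iu).
rewrite big_cons mulrDl expRD EFinM -muleA lee_pmul2l ?lte_fin ?expR_gt0//.
have /IH /le_trans -> // : forall i, i \notin l -> m i = t i.
  move=> i il; rewrite /m; have [->//|iu] := eqVneq i u.
  by apply: st; rewrite inE negb_or iu.
rewrite lee_wpmul2r// lee_fin ler_expR ler_pM2r ?invr_gt0//.
(* [l] may contain [u] again; such terms vanish for [m], so the sum can only decrease. *)
apply: ler_sum => i _; rewrite /m; case: eqP => [->|//].
by rewrite subrr normr0.
Qed.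

Lemma shifted_le (s t : I -> R) (B : set (coord_space I R)) : measurable B ->
  (P (shifted s @^-1` B) <=
   (expR ((\sum_i `|s i - t i|) / b))%:E * P (shifted t @^-1` B))%E.
Proof.
by apply: shifted_le_seq => i; rewrite mem_index_enum.
Qed.

End laplace_mechanism.

(** * Sensitivity of the frequency vectors *)

Lemma adjacent_datasets_size (N : nat) (dom : 'I_N -> finType)
  (D D' : dataset dom) : adjacent_datasets D D' -> size D = size D'.
Proof. by case=> s [x [x' [/perm_size -> /perm_size ->]]]. Qed.

(** The common records [s] cancel, and each of the two remaining records lies in exactly one cell,
    hence contributes at most 1. *)
Lemma freq_sensitivity (R : realType) (N : nat) (dom : 'I_N -> finType)
    (D D' : dataset dom) (A : {set 'I_N}) : adjacent_datasets D D' ->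
  \sum_i `|freq R D A i 0 - freq R D' A i 0| <= 2.
Proof.
case=> s [x [x' [Ds D's]]].
have sum1 (y : record dom) :
    \sum_(i < #|cell dom A|) ((restrict_to A y == enum_val i)%:R : R) = 1.
  rewrite (bigD1 (enum_rank (restrict_to A y)))//= enum_rankK eqxx.
  rewrite big1 ?addr0//.
  move=> i iy; case: eqP => // yi; move: iy.
  by rewrite yi enum_valK eqxx.
apply: (@le_trans _ _ (\sum_(i < #|cell dom A|)
    ((restrict_to A x == enum_val i)%:R +
     (restrict_to A x' == enum_val i)%:R))).
  apply: ler_sum => i _; rewrite !mxE (permP Ds) (permP D's) /= !natrD.
  by rewrite opprD addrACA subrr addr0 (le_trans (ler_normB _ _))// !normr_nat.
by rewrite big_split/= !sum1.
Qed.

Lemma card_ksubset (N k : nat) : #|{: ksubset N k}| = 'C(N, k.+1).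
Proof.
rewrite card_sig -[in RHS](card_ord N) -card_draws.
by apply: eq_card => A; rewrite !inE.
Qed.

(** * The analyst's computation as post-processing *)

Section post_processing.
Context (R : realType) (N k M : nat) (dom : 'I_N -> finType).
Context (x0 : 'I_N) (cover : 'I_N -> {set 'I_N} -> ksubset N k)
  (tie : network N -> {set 'I_N * {set 'I_N}} -> 'I_N * {set 'I_N}).

(** The record count [n] is a parameter, so that the map sees the data only through the transcript
    [c]. *)
Definition publish (n : nat) (c : transcript R M k dom) :
    transcript R M k dom * network N :=
  (c, learn k tie x0 (score cover n c)).

(* With the entries of c minus the frequencies of D as the noise, sharing D
   yields c. *)
Lemma measurable_publish d (T : measurableType d)
    (c : T -> transcript R M k dom) (D : 'I_M -> dataset dom) :
  (forall j A i, measurable_fun setT (fun w => c w j A i 0)) ->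
  measurable_fun setT (fun w => publish (\sum_j size (D j))%N (c w)).
Proof.
(* The noises are typed as random variables over a probability; a Dirac mass supplies one. *)
move=> mc; pose P : probability T R := dirac point.
have meta j A i : measurable_fun setT
    (fun w => c w j A i 0 - freq R (D j) (val A) i 0).
  exact: (measurable_funB (mc j A i) (measurable_cst _)).
pose eta j A i : {RV P >-> R} :=
  HB.pack (fun w => c w j A i 0 - freq R (D j) (val A) i 0)
    (isMeasurableFun.Build _ _ _ _ _ (meta j A i)).
have shareE w : share eta D w = c w.
  apply/functional_extensionality_dep => j.
  apply/functional_extensionality_dep => A.
  apply/matrixP => i l; rewrite ord1 [LHS]mxE [X in _ + X]mxE /eta /=.
  by rewrite addrC subrK.
rewrite (_ : (fun w => publish _ (c w)) = share_and_learn eta x0 cover tie D).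
  exact: measurable_share_and_learn.
by apply/funext => w; rewrite /share_and_learn shareE.
Qed.

End post_processing.

(** * Privacy of the sharing protocol *)

Theorem theorem3p4 (R : realType) (N k M : nat) (dom : 'I_N -> finType)
  (hkN : (k.+1 <= N)%N) (eps : R) (heps : 0 < eps)
  (d : measure_display) (Omega : measurableType d) (P : probability Omega R)
  (eta : forall (j : 'I_M) (A : ksubset N k),
     'I_#|cell dom (val A)| -> {RV P >-> R})
  (heta_laplace : forall j A i,
     is_laplace 0 (2 * 'C(N, k.+1)%:R / eps) (eta j A i))
  (heta_indep : mutually_independent
     (fun u : 'I_M * {A : ksubset N k & 'I_#|cell dom (val A)|} =>
        eta u.1 (tag u.2) (tagged u.2)))
  (x0 : 'I_N)
  (cover : 'I_N -> {set 'I_N} -> ksubset N k)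
  (hcover : forall (X : 'I_N) (Pa : {set 'I_N}), X \notin Pa -> (#|Pa| <= k)%N ->
     (X |: Pa)%SET \subset val (cover X Pa))
  (tie : network N -> {set 'I_N * {set 'I_N}} -> 'I_N * {set 'I_N})
  (htie : forall (G : network N) (S : {set 'I_N * {set 'I_N}}), S != finset.set0 -> tie G S \in S)
  (D : 'I_M -> dataset dom) (j : 'I_M) :
  differentially_private (@adjacent_datasets N dom) eps
    (fun Dj : dataset dom =>
       sharing_noisy_stats eta x0 cover tie [eta D with j |-> Dj]).
Proof.
move=> Dj Dj' adj O mO.
(* One index per shared number: holder, attribute set, cell. *)
pose I : finType := ('I_M * {A : ksubset N k & 'I_#|cell dom (val A)|})%type.
pose E x i := [eta D with j |-> x] i : dataset dom.
pose f (x : dataset dom) (u : I) : R :=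
  freq R (E x u.1) (val (tag u.2)) (tagged u.2) 0.
pose ix (A : ksubset N k) (l : 'I_#|cell dom (val A)|) :=
  Tagged (fun A : ksubset N k => 'I_#|cell dom (val A)|) l.
pose Z (u : I) := eta u.1 (tag u.2) (tagged u.2).
(* Adjacent datasets have equal sizes, so both runs use the same post-processing map. *)
pose n := (\sum_i size (E Dj i))%N.
have nE : (\sum_i size (E Dj' i))%N = n.
  apply: eq_bigr => i _; rewrite /E /=; case: eqP => // _.
  by rewrite (adjacent_datasets_size adj).
(* Regroups a flat family of reals into the vectors of a transcript. *)
pose tr (v : coord_space I R) : transcript R M k dom :=
  fun i A => \col_l v (i, ix A l).
have mB : measurable ((fun v => publish x0 cover tie n (tr v)) @^-1` O).
  rewrite -[X in measurable X]setTI; apply: measurable_publish => // i A l.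
  rewrite (_ : (fun w => tr w i A l 0) =
      fun v : coord_space I R => v (i, ix A l)).
    exact: measurable_coord.
  by apply/funext => v; rewrite mxE.
have shareE x w : share eta (E x) w = tr (shifted Z (f x) w).
  apply/functional_extensionality_dep => i.
  apply/functional_extensionality_dep => A.
  apply/matrixP => l l'; rewrite ord1 [LHS]mxE [X in _ + X]mxE [RHS]mxE.
  exact: addrC.
have algE x : (\sum_i size (E x i))%N = n ->
    distribution P (sharing_noisy_stats eta x0 cover tie (E x)) O =
    P (shifted Z (f x) @^-1`
       ((fun v => publish x0 cover tie n (tr v)) @^-1` O)).
  move=> xn.
  have sE : share_and_learn eta x0 cover tie (E x) =
      fun w => publish x0 cover tie n (tr (shifted Z (f x) w)).
    by apply/funext => w; rewrite /share_and_learn xn shareE.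
  transitivity (P (share_and_learn eta x0 cover tie (E x) @^-1` O)).
    exact: erefl.
  by rewrite sE.
rewrite (algE Dj)// (algE Dj')//.
(* [k.+1 <= N] makes the binomial, and with it the noise scale, positive. *)
have C0 : (0 : R) < 'C(N, k.+1)%:R by rewrite ltr0n bin_gt0.
have b0 : 0 < 2 * 'C(N, k.+1)%:R / eps by rewrite divr_gt0 ?mulr_gt0.
have Zl u : is_laplace 0 (2 * 'C(N, k.+1)%:R / eps) (Z u).
  exact: heta_laplace.
apply: le_trans (shifted_le b0 Zl heta_indep (f Dj) (f Dj') mB) _.
(* For the scale [2 * 'C(N, k.+1) / eps], an exponent at most [eps] means an L1 distance at most
   [2 * 'C(N, k.+1)]. *)
rewrite lee_wpmul2r// lee_fin ler_expR ler_pdivrMr// mulrC divfK ?gt_eqF//.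
rewrite -(pair_bigA _ (fun i v => `|f Dj (i, v) - f Dj' (i, v)|))/=.
rewrite (bigD1 j)//= [X in _ + X]big1 ?addr0; last first.
  move=> i ij; apply: big1 => v _.
  by rewrite /f /E /= (negbTE ij) subrr normr0.
rewrite -(sig_big_dep (fun=> true) (fun _ _ => true)
  (fun A (l : 'I_#|cell dom (val A)|) =>
    `|f Dj (j, ix A l) - f Dj' (j, ix A l)|))/=.
apply: (@le_trans _ _ (\sum_(A : ksubset N k) 2)).
  apply: ler_sum => A _; apply: le_trans (freq_sensitivity R (val A) adj).
  by apply: ler_sum => l _; rewrite /f /E /= eqxx.
by rewrite sumr_const card_ksubset mulr_natr.
Qed.
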